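(* Let $\mathbf{A}$ be an idempotent algebra and let $\mathbf{R}\le\mathbf{A}^2$ contain a directed closed walk (i.e. there are $a_0,a_1,\dots,a_m\in A$, $m\ge1$, with $(a_{i-1},a_i)\in R$ for all $i$ and $a_m=a_0$). If $R$ locally absorbs the equality relation $=_A=\{(a,a):a\in A\}$, then $R$ contains a loop, i.e. a pair $(a,a)$.
   Context: Operations of $\mathbf{A}$ are applied coordinatewise. A tuple $(u_1,\dots,u_n)$ is a one-$S$-in-$R$ tuple if for exactly one $i$ we have $u_i\in S$ and all other $u_i$ are in $R$. For $\mathbf{R}\le\mathbf{A}^2$ and $S\subseteq A^2$, $R$ locally $n$-absorbs $S$ if for every finite set $\mathcal{C}$ of one-$S$-in-$R$ tuples of length $n$ there is an $n$-ary term operation $t$ of $\mathbf{A}$ with $t(u_1,\dots,u_n)\in R$ for all $(u_1,\dots,u_n)\in\mathcal{C}$; $R$ locally absorbs $S$ if it locally $n$-absorbs $S$ for some $n$. An algebra is idempotent if every basic operation $f$ satisfies $f(a,\dots,a)=a$. *)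

(* Defs.v *)
From mathcomp Require Import all_boot.
From mathcomp Require Import boolp classical_sets functions cardinality.

Set Implicit Arguments.
Unset Strict Implicit.
Unset Printing Implicit Defensive.

Local Open Scope classical_set_scope.

Record signature := Signature { symbol : Type; arity : symbol -> nat }.

Record algebra (Sg : signature) := Algebra {
  carrier :> Type;
  basic_op : forall f : symbol Sg, ('I_(arity f) -> carrier) -> carrier }.

Definition idempotent_algebra Sg (A : algebra Sg) : Prop :=
  forall (f : symbol Sg) (a : A), basic_op (fun _ : 'I_(arity f) => a) = a.

Inductive term (Sg : signature) (n : nat) : Type :=
| Var of 'I_n
| App (f : symbol Sg) of ('I_(arity f) -> term Sg n).

Fixpoint eval Sg (A : algebra Sg) n (e : term Sg n) (u : 'I_n -> A) : A :=
  match e with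
  | Var i => u i
  | App f es => basic_op (fun i => eval (es i) u)
  end.

Definition term_operation Sg (A : algebra Sg) n : set (('I_n -> A) -> A) :=
  [set t | exists e : term Sg n, t = eval e].

Arguments term_operation {Sg} A n.

Definition coordinatewise (T : Type) n (t : ('I_n -> T) -> T)
    (u : 'I_n -> T * T) : T * T :=
  (t (fun i => (u i).1), t (fun i => (u i).2)).

Definition subalgebra_sq Sg (A : algebra Sg) (R : set (A * A)) : Prop :=
  forall (f : symbol Sg) (u : 'I_(arity f) -> A * A),
    (forall i, R (u i)) -> R (coordinatewise (@basic_op Sg A f) u).

(* "Exactly one" is read literally: no other coordinate may lie in S, even
   when R and S intersect. *)
Definition one_in (T : Type) (S R : set T) n (u : 'I_n -> T) : Prop :=
  exists i, [/\ S (u i), forall j, S (u j) -> j = i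
              & forall j, j <> i -> R (u j)].

Definition locally_n_absorbs Sg (A : algebra Sg) n (R S : set (A * A)) : Prop :=
  forall C : set ('I_n -> A * A), finite_set C -> C `<=` @one_in _ S R n ->
    exists2 t, term_operation A n t
             & forall u, C u -> R (coordinatewise t u).

(* n = 0 is not excluded: there are no one-S-in-R tuples of length 0, and a
   0-ary term exists only if the signature has constants, which in an
   idempotent algebra forces A to have at most one element. *)
Definition locally_absorbs Sg (A : algebra Sg) (R S : set (A * A)) : Prop :=
  exists n, locally_n_absorbs n R S.

Definition has_closed_walk (T : Type) (R : set (T * T)) : Prop :=
  exists (m : nat) (a : nat -> T),
    [/\ 1 <= m, forall i, 1 <= i <= m -> R (a i.-1, a i) & a m = a 0].

(* Main.v *)
Require Import Defs.
From mathcomp Require Import all_boot.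
From mathcomp Require Import boolp classical_sets functions cardinality.
From mathcomp Require Import zify.

(** Suppose R has no loop.  Idling the coordinates of an absorbing term one after
the other along a closed walk of length m through v gives closed walks through v
of every large length.

Fix the arity n and let t be a term absorbing a suitable finite set of tuples.
For a labelling f of the words of length K + 1 over n letters, let p be the value
of the t-tree of depth K + 1 with leaves f, and x_i its i-th subtree.  By
idempotence x_i is also the tree of depth K + 1 with leaves f (i :: w_1 ... w_K)
at w_1 ... w_{K+1}, so p -> x_i holds as soon as for all words x of length K the
edges f (rcons x c) -> f (i :: x) exist for all letters c, except for at most one
c for which the two labels are equal; absorption is used only at the last level
of the tree.  Then p = t(p, ..., p) -> t(x_1, ..., x_n) = p is a loop.

Reading words as sliding windows on a sequence of letters, f has to follow R
backwards at every shift, with a pause allowed only when the new letter is the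
one predicted by the window.  Such an f comes from Krieger's marker lemma: where
the sequence has no small period there are locally determined markers at bounded
distances, joined by closed walks of the right lengths; where it is periodic, the
next letter is predicted and f may rest at v. *)

(** * Greedy choice of separated, locally determined markers *)

Section Markers.
Variable N : nat.

(* Greedy over the colours: a position of colour [i] is marked at stage [i] unless
   a position within distance [N] was marked before. *)
Fixpoint mark (j : nat) (c : nat -> nat) (s : nat) : Prop :=
  if j is i.+1 then
    mark i c s \/
    c s = i /\ forall s', s' <= s + N -> s <= s' + N -> ~ mark i c s'
  else False.

Lemma mark_color j c s : mark j c s -> c s < j.
Proof. by elim: j => [|j IH] //= [/IH|[-> _]]; lia. Qed.

Lemma mark_separated j c s s' :
    (forall q q', q < q' <= q + N -> c q = c q' -> j <= c q) ->
  mark j c s -> mark j c s' -> s < s' -> s + N < s'.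
Proof.
elim: j s s' => [|j IH] s s' //= cN ms ms' lt_ss'.
rewrite ltnNge; apply/negP => le_s's.
case: ms => [ms|[cs ms]]; case: ms' => [ms'|[cs' ms']].
- suff: s + N < s' by lia.
  by apply: IH => // q q' hq eq; have := cN q q' hq eq; lia.
- by apply: ms' ms; lia.
- by apply: ms ms'; lia.
- by have := cN s s'; rewrite lt_ss' le_s's cs cs' => /(_ isT erefl); lia.
Qed.

Lemma mark_dominates j c s : c s < j ->
  exists s', [/\ s' <= s + N, s <= s' + N & mark j c s'].
Proof.
elim: j => [|j IH] //=; rewrite ltnS leq_eqVlt => /orP[/eqP cs|/IH]; last first.
  by move=> [s' [? ? ?]]; exists s'; split=> //; left.
have [[s' [? ? ?]]|none] := pselect (exists s', [/\ s' <= s + N, s <= s' + N & mark j c s']).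
  by exists s'; split=> //; left.
exists s; split; rewrite ?leq_addr //; right; split=> // s' h h' m.
by apply: none; exists s'.
Qed.

(** Each stage looks at distance at most [N], so [j] stages use only colours within distance
    [j * N]. *)
Lemma mark_local j c c' a a' l i :
    (forall i, i < l -> c (a + i) = c' (a' + i)) ->
  j * N <= i -> i + j * N < l -> mark j c (a + i) <-> mark j c' (a' + i).
Proof.
elim: j a a' l i c c' => [|j IH] a a' l i c c' eqc //= h1 h2.
rewrite mulSn in h1 h2.
rewrite eqc; last lia.
have [//||e1 e2] := IH a a' l i c c' eqc; try lia.
have nb u u' d d' : (forall i, i < l -> d (u + i) = d' (u' + i)) ->
  (forall s', s' <= u + i + N -> u + i <= s' + N -> ~ mark j d s') ->
  (forall s', s' <= u' + i + N -> u' + i <= s' + N -> ~ mark j d' s').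
  move=> eqd H s' h3 h4 ms'.
  have es' : s' = u' + (s' - u') by lia.
  rewrite es' in ms'.
  apply: (H (u + (s' - u'))); [lia..|].
  by apply/(IH _ _ l _ _ _ eqd) => //; lia.
by split=> -[m|[cj m]]; [left; tauto|right; split=> //; exact: nb m|
  left; tauto|right; split=> //; apply: nb m => i' /eqc].
Qed.

End Markers.

(** * Runs through successive closed walks *)

Section Machine.
Variable gap : nat -> nat.

(* A state [(g, j)] means: [j] steps of a closed walk of length [g] have been
   made; [(1, 0)] is the base point, where the length of the next closed walk is
   looked up in [gap]. *)
Definition step (q : nat) (st : nat * nat) : nat * nat :=
  let g := if st.2 == 0 then gap q else st.1 in
  if st.2.+1 == g then (1, 0) else (g, st.2.+1).

Fixpoint run (s l : nat) : nat * nat :=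
  if l is i.+1 then step (s + i) (run s i) else (1, 0).

Definition visits (s q : nat) : Prop := exists2 l, q = s + l & run s l = (1, 0).

Lemma visits_refl s : visits s s.
Proof. by exists 0; rewrite ?addn0. Qed.

Lemma run_add s l i : run s l = (1, 0) -> run s (l + i) = run (s + l) i.
Proof.
by move=> base; elim: i => [|i IH]; rewrite ?addn0 // addnS /= IH addnA.
Qed.

(** A visit to the base point erases the past of a run. *)
Lemma run_eq s s' q l l' : visits s q -> visits s' q -> s + l = s' + l' ->
  q <= s + l -> run s l = run s' l'.
Proof.
move=> [i -> bi] [i' e bi'] el le.
have -> : l = i + (l - i) by lia.
have -> : l' = i' + (l - i) by lia.
by rewrite !run_add // e.
Qed.

Hypothesis gap_gt0 : forall q, 0 < gap q.

Lemma run_state s l : let: (g, j) := run s l in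
  j = 0 /\ g = 1 \/ 0 < j < g /\ exists q, g = gap q.
Proof.
elim: l => [|l]; first by left.
rewrite /= /step; case: (run s l) => g [|j] /= IH.
  have := gap_gt0 (s + l); case: eqP; first by left.
  by right; split; [lia|exists (s + l)].
case: eqP; first by left.
by case: IH => [[]//|[? ?]]; right; split=> //; lia.
Qed.

Lemma visits_gap s q : visits s q -> visits s (q + gap q).
Proof.
move=> [l -> base]; exists (l + gap (s + l)); first by rewrite addnA.
rewrite run_add //; have := gap_gt0 (s + l); move: (s + l) => q0.
have inside i : 0 < i < gap q0 -> run q0 i = (gap q0, i).
  elim: i => // -[|i] IH ltg /=; first by rewrite /step /= addn0; case: eqP; [lia|].
  by rewrite [X in step _ X]IH; [rewrite /step /=; case: eqP; [lia|] | lia].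
case e: (gap q0) inside => [|[|g]] inside _; first by move: (gap_gt0 q0); rewrite e.
  by rewrite /= /step /= addn0 e.
rewrite -[run _ _.+2]/(step (q0 + g.+1) (run q0 g.+1)) inside; last lia.
by rewrite /step /= eqxx.
Qed.

Lemma visits_within B s q a : (forall q, gap q <= B) ->
  visits s q -> q <= a -> exists q', [/\ visits s q', a <= q' & q' < a + B].
Proof.
move=> gapB; have [n] := ubnP (a - q); elim: n q => // n IH q ltn vq le_qa.
have [le|lt] := leqP a (q + gap q); last first.
  by apply: IH (visits_gap _ _ vq) _; have := gap_gt0 q; lia.
move: le_qa; rewrite leq_eqVlt => /orP[/eqP <-|lt_qa].
  by exists q; split=> //; have := gap_gt0 q; have := gapB q; lia.
by exists (q + gap q); split=> //; [exact: visits_gap|have := gapB q; lia].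
Qed.

End Machine.

Lemma run_ext gap gap' s s' l :
    (forall i, i < l -> gap (s + i) = gap' (s' + i)) ->
  run gap s l = run gap' s' l.
Proof.
elim: l => [//|l IH] eqg; rewrite /= -IH => [|i lti]; last by apply: eqg; lia.
by rewrite /step eqg.
Qed.

(** * Walk lengths that steer runs to common markers *)

Section Gap.
Variables (N : nat) (F P : nat -> Prop).

(** Length 1 encodes a pause at the base point, the only length not realised by a closed walk.
    Aiming at [F] positions makes different runs meet. *)
Definition gap (q : nat) : nat :=
  let d := find (fun d => `[< F (q + d) >]) (iota N.+1 N.+1) in
  if d <= N then N.+1 + d else if `[< P q >] then 1 else N.+1.

Lemma gap_spec q :
  (exists2 d, F (q + d) & N < d <= N.*2.+1 /\ gap q = d) \/
  (forall d, N < d <= N.*2.+1 -> ~ F (q + d)) /\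
  (P q /\ gap q = 1 \/ ~ P q /\ gap q = N.+1).
Proof.
rewrite /gap; set a : pred nat := (fun d => `[< _ >]); set r := iota _ _.
have [h|h] := boolP (has a r).
  have lt : find a r < N.+1 by rewrite -[X in _ < X](size_iota N.+1) -has_find.
  left; exists (N.+1 + find a r); last by rewrite ifT //; split=> //; lia.
  by have := nth_find 0 h; rewrite nth_iota => [/asboolP|]; rewrite ?ltnS.
right; split.
  move=> d hd Fd; move/hasPn: h => /(_ d); rewrite mem_iota.
  by move=> /(_ ltac:(lia)) /asboolP.
rewrite hasNfind // size_iota ltnn.
by case: asboolP => Pq; [left|right].
Qed.

Lemma gap_gt0 q : 0 < gap q.
Proof. by case: (gap_spec q) => [[d _ [? ->]]|[_ [[_ ->]|[_ ->]]]] //; lia. Qed.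

Lemma gap_bound q : gap q <= N.*2.+1.
Proof. by case: (gap_spec q) => [[d _ [? ->]]|[_ [[_ ->]|[_ ->]]]] //; lia. Qed.

Lemma gap_range q : gap q = 1 \/ N < gap q.
Proof. by case: (gap_spec q) => [[d _ [? ->]]|[_ [[_ ->]|[_ ->]]]]; auto; lia. Qed.

Hypothesis F_sep : forall s s', F s -> F s' -> s < s' -> s + N < s'.
Hypothesis P_noF : forall q d, P q -> d <= N -> ~ F (q + d).

Definition clear (q : nat) : Prop := forall d, 0 < d <= N -> ~ F (q + d).

Lemma clear_gap q : clear (q + gap q).
Proof.
move=> d hd Fd; case: (gap_spec q) => [[e Fe [he eg]]|[none [[Pq eg]|[_ eg]]]];
  rewrite eg -addnA in Fd.
- by have := F_sep _ _ Fe Fd; lia.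
- have [le|lt] := leqP (1 + d) N; first exact: P_noF Pq le Fd.
  by apply: none Fd; lia.
- by apply: none Fd; lia.
Qed.

(** From a clear base point an [F] position is more than [N] away and cannot be jumped over, since
    separation leaves at most one target in reach. [clear_gap] keeps the invariant. *)
Lemma visits_mark s q m : visits gap s q -> clear q -> F m -> q < m ->
  visits gap s m.
Proof.
have [n] := ubnP (m - q); elim: n q => // n IH q ltn vq cq Fm lt_qm.
have [lt|le] := ltnP (q + gap q) m.
  by apply: IH (visits_gap _ gap_gt0 _ _ vq) (clear_gap q) Fm lt; have := gap_gt0 q; lia.
suff -> : m = q + gap q by exact: visits_gap gap_gt0 _ _ vq.
apply/eqP; rewrite eqn_leq le /=.
have em : m = q + (m - q) by lia.
have far : N < m - q.
  by rewrite ltnNge; apply/negP => near; apply: (cq (m - q)); rewrite -?em //; lia.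
case: (gap_spec q) => [[e Fe [he eg]]|[none eg]]; last first.
  by exfalso; apply: (none (m - q)); rewrite -?em //; case: eg => [[_ eg]|[_ eg]]; lia.
rewrite eg in le *; rewrite leqNgt; apply/negP => lt.
by have := F_sep _ _ Fm Fe lt; lia.
Qed.

Lemma visits_rest s q a b : visits gap s q -> a <= q <= b ->
    (forall i, a <= i < b -> P i /\ forall d, N < d <= N.*2.+1 -> ~ F (i + d)) ->
  visits gap s b.
Proof.
move=> vq /andP[le_aq]; elim: b => [|b IH] le_qb rest.
  by have -> : 0 = q by lia.
move: le_qb; rewrite leq_eqVlt => /orP[/eqP <- //|lt_qb].
have vb : visits gap s b by apply: IH => // i hi; apply: rest; lia.
have [|Pb none] := rest b; first lia.
have := visits_gap _ gap_gt0 _ _ vb.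
case: (gap_spec b) => [[d /none Fd [/Fd//]]|[_ [[_ ->]|[//]]]].
by rewrite addn1.
Qed.

End Gap.

Lemma gap_ext N F F' (P P' : nat -> Prop) q q' :
    (forall d, N < d <= N.*2.+1 -> F (q + d) <-> F' (q' + d)) ->
    (P q <-> P' q') ->
  gap N F P q = gap N F' P' q'.
Proof.
move=> eF eP; rewrite /gap (asbool_equiv_eq eP).
rewrite (@eq_in_find _ _ (fun d => `[< F' (q' + d) >])) // => d.
by rewrite mem_iota => hd; apply/asbool_equiv_eq/eF; lia.
Qed.

(** * Periodic blocks, markers of a sequence, synchronisation of runs *)

Section Periodic.
Variables (T : finType) (N : nat).
Implicit Types z : nat -> T.

Definition periodic z (s l : nat) : Prop :=
  exists2 p, 0 < p <= N & forall i, i + p < l -> z (s + i) = z (s + i + p).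

Lemma periodic_sub z s l s' l' : s <= s' -> s' + l' <= s + l ->
  periodic z s l -> periodic z s' l'.
Proof.
move=> h1 h2 [p hp per]; exists p => // i hi.
have -> : s' + i = s + (s' - s + i) by lia.
by apply: per; lia.
Qed.

Lemma periodic_ext z z' s s' l : (forall i, i < l -> z (s + i) = z' (s' + i)) ->
  periodic z s l <-> periodic z' s' l.
Proof.
move=> e; split=> -[p hp per]; exists p => // i hi.
  by rewrite -addnA -!e //; [rewrite addnA; exact: per|lia].
by rewrite -addnA !e //; [rewrite addnA; exact: per|lia].
Qed.

(** A new last letter is traced back by the period of the last window, then by that of the prefix,
    then forward by the former; length [2 N + 1] has room for both periods. *)
Lemma periodic_glue z a h :
    (forall i, i <= h -> periodic z (a + i) N.*2.+1) ->
  periodic z a (N.*2.+1 + h).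
Proof.
elim: h => [|h IH] per; first by have := per 0 isT; rewrite !addn0.
have /IH [p hp perp] : forall i, i <= h -> periodic z (a + i) N.*2.+1.
  by move=> i hi; apply: per; lia.
have [q hq perq] := per h.+1 (leqnn _).
exists p => // i hi; have [lt|eq_h] := ltnP (i + p) (N.*2.+1 + h); first exact: perp.
have e1 := perp (i - q) ltac:(lia).
have e2 := perq (i - q - h.+1) ltac:(lia).
have e3 := perq (i + p - q - h.+1) ltac:(lia).
have x2 : a + h.+1 + (i - q - h.+1) = a + (i - q) by lia.
have x3 : a + h.+1 + (i + p - q - h.+1) = a + (i - q) + p by lia.
rewrite x2 in e2; rewrite x3 -e1 e2 in e3.
have y2 : a + (i - q) + q = a + i by lia.
by rewrite -y2 e3 addnAC.
Qed.

(** Both letters are traced back, by the two periods in either order, to position [q + D - p - p'],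
    where the sequences agree. *)
Lemma periodic_predict z z' q D : N.*2 <= D ->
    (forall i, i < D -> z (q + i) = z' (q + i)) ->
  periodic z q D.+1 -> periodic z' q D.+1 -> z (q + D) = z' (q + D).
Proof.
move=> hD e [p hp per] [p' hp' per'].
have e1 := per (D - p) ltac:(lia); have e2 := per' (D - p') ltac:(lia).
have e3 := per (D - p' - p) ltac:(lia); have e4 := per' (D - p - p') ltac:(lia).
have -> : q + D = q + (D - p) + p by lia.
rewrite -e1 e; last lia.
have -> : q + (D - p) = q + (D - p - p') + p' by lia.
rewrite -e4 -e; last lia.
have -> : q + (D - p - p') = q + (D - p' - p) by lia.
rewrite e3 -addnA e; last lia.
have -> : q + (D - p' - p + p) = q + (D - p') by lia.
by rewrite e2; congr z'; lia.
Qed.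

Local Notation blocks := {ffun 'I_N.*2.+1 -> T}.

Definition color z (s : nat) : nat :=
  if `[< periodic z s N.*2.+1 >] then #|blocks|
  else enum_rank [ffun i : 'I_N.*2.+1 => z (s + i)].

Lemma color_lt z s : ~ periodic z s N.*2.+1 -> color z s < #|blocks|.
Proof. by rewrite /color; case: asboolP => // _ _; exact: ltn_ord. Qed.

(** Equal blocks at distance at most [N] have that distance as a period, so only the colour reserved
    for periodic blocks can repeat. *)
Lemma color_repeat z s s' : s < s' <= s + N -> color z s = color z s' ->
  #|blocks| <= color z s.
Proof.
move=> hs; rewrite leqNgt => e; apply/negP => lt; move: (lt); rewrite [in X in X -> _]e.
move: e lt; rewrite /color; case: asboolP => [|nper]; first by rewrite ltnn.
case: asboolP => [|_]; first by rewrite ltnn.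
move=> /ord_inj/enum_rank_inj/ffunP e _ _; apply: nper.
exists (s' - s); first lia.
move=> i hi; have lti : i < N.*2.+1 by lia.
have := e (Ordinal lti); rewrite !ffunE /= => ->.
by congr z; lia.
Qed.

Lemma color_ext z z' s s' :
    (forall i, i < N.*2.+1 -> z (s + i) = z' (s' + i)) ->
  color z s = color z' s'.
Proof.
move=> e; rewrite /color (asbool_equiv_eq (periodic_ext _ _ _ _ _ e)).
case: asboolP => // _; congr (nat_of_ord (enum_rank _)).
by apply/ffunP => i; rewrite !ffunE e.
Qed.

Definition marker z : nat -> Prop := mark N #|blocks| (color z).

Lemma marker_sep z s s' : marker z s -> marker z s' -> s < s' -> s + N < s'.
Proof. by apply: mark_separated => q q'; exact: color_repeat. Qed.

Lemma marker_aperiodic z s : marker z s -> ~ periodic z s N.*2.+1.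
Proof.
by move=> /mark_color; rewrite /color; case: asboolP => //; rewrite ltnn.
Qed.

Definition radius := #|blocks| * N.

Lemma marker_local z z' a a' l i :
    (forall i, i < l -> z (a + i) = z' (a' + i)) ->
  radius <= i -> i + radius + N.*2.+1 <= l ->
  marker z (a + i) <-> marker z' (a' + i).
Proof.
move=> e h1 h2; apply: (mark_local _ _ _ _ _ _ (l - N.*2)) => //; last by rewrite -/radius; lia.
by move=> j hj; apply: color_ext => h hh; rewrite -!addnA; apply: e; lia.
Qed.

(* [marker z (q + d)] for [d <= N.*2.+1] depends on letters before
   [q + lookahead] only, so that in [gaps] the letter at [q + lookahead] matters
   only for the periodicity test. *)
Definition lookahead := N.*2.+1 + radius + N.*2.+1.

Definition gaps z : nat -> nat :=
  gap N (marker z) (fun q => periodic z q lookahead.+1).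

Lemma gaps_local z z' a a' l i :
    (forall i, i < l -> z (a + i) = z' (a' + i)) ->
  radius <= i -> i + lookahead < l -> gaps z (a + i) = gaps z' (a' + i).
Proof.
move=> e h1 h2; apply: gap_ext.
  by move=> d hd; rewrite -!addnA; apply: (marker_local _ _ _ _ l) => //; rewrite /lookahead in h2; lia.
by apply: periodic_ext => j hj; rewrite -!addnA; apply: e; lia.
Qed.

Lemma gaps_stay z z' q :
    (forall i, i < q + lookahead -> z i = z' i) ->
  gaps z q = 1 -> gaps z' q = 1 -> 0 < N -> z (q + lookahead) = z' (q + lookahead).
Proof.
move=> e g1 g1' N_gt0.
have := gap_spec N (marker z) (fun q => periodic z q lookahead.+1) q.
rewrite -/(gaps z q) g1; case=> [[d _ ?]|[_ [[per _]|[_ ?]]]]; [lia| |lia].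
have := gap_spec N (marker z') (fun q => periodic z' q lookahead.+1) q.
rewrite -/(gaps z' q) g1'; case=> [[d _ ?]|[_ [[per' _]|[_ ?]]]]; [lia| |lia].
apply: periodic_predict per per'; first by rewrite /lookahead; lia.
by move=> i hi; apply: e; lia.
Qed.

Lemma periodic_unmarked z q d : periodic z q lookahead.+1 -> d <= N ->
  ~ marker z (q + d).
Proof.
move=> per hd /marker_aperiodic; apply.
by apply: periodic_sub per; rewrite /lookahead; lia.
Qed.

(** [2 N + 2] steps bring both runs to clear base points; [4 N + lookahead + 2] more reach a marker
    or cross a long periodic stretch. *)
Definition delay := 6 * N + lookahead + 4.

(** From clear base points both runs visit the next marker. If none is near, all windows are
    periodic, the stretch is periodic by gluing, and both runs come to rest. *)
Lemma run_sync z s : run (gaps z) s delay.+1 = run (gaps z) s.+1 delay.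
Proof.
have gt0 := gap_gt0 N (marker z) (fun q => periodic z q lookahead.+1).
have le := gap_bound N (marker z) (fun q => periodic z q lookahead.+1).
suff [q hq [v v']] : exists2 q, q <= s + delay.+1 &
    visits (gaps z) s q /\ visits (gaps z) s.+1 q.
  by apply: (run_eq _ _ _ _ _ _ v v' _ hq); lia.
have cl := clear_gap N _ _ (marker_sep z) (periodic_unmarked z).
set a := s + N.*2.+2.
have [c [vc hc cc]] : exists c, [/\ visits (gaps z) s c, c <= a & clear N (marker z) c].
  exists (s + gaps z s); split; [exact: visits_gap gt0 _ _ (visits_refl _ _)| |exact: cl].
  by have := le s; rewrite -/(gaps z s) /a; lia.
have [c' [vc' hc' cc']] : exists c, [/\ visits (gaps z) s.+1 c, c <= a & clear N (marker z) c].
  exists (s.+1 + gaps z s.+1); split; [exact: visits_gap gt0 _ _ (visits_refl _ _)| |exact: cl].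
  by have := le s.+1; rewrite -/(gaps z s.+1) /a; lia.
pose X := 4 * N + lookahead + 2.
have [[m hm Fm]|none] := pselect (exists2 m, a < m <= a + X & marker z m).
  exists m; first by rewrite /delay; lia.
  split; apply: (visits_mark _ _ _ (marker_sep z) (periodic_unmarked z)) Fm _; eauto; lia.
have free q : a < q <= a + X -> ~ marker z q by move=> hq Fq; apply: none; exists q.
have per i : i <= X - N.*2.+1 -> periodic z (a + N.+1 + i) N.*2.+1.
  move=> hi; apply: contrapT => /color_lt /mark_dominates -/(_ N) [m [h1 h2]].
  by apply: free; lia.
have {}per := periodic_glue _ _ _ per.
exists (a + N.+1 + N.*2.+1); first by rewrite /delay /a; lia.
have rest t q : visits (gaps z) t q -> q <= a -> visits (gaps z) t (a + N.+1 + N.*2.+1).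
  move=> vq hq.
  have [|q' [vq' h1 h2]] := visits_within _ gt0 N.*2.+1 _ _ (a + N.+1) le vq; first lia.
  apply: (visits_rest _ _ _ _ _ (a + N.+1) _ vq'); first lia.
  move=> i hi; split; first by apply: periodic_sub per; rewrite /X /lookahead; lia.
  by move=> d hd; apply: free; rewrite /X /lookahead; lia.
by split; [exact: rest vc hc|exact: rest vc' hc'].
Qed.

End Periodic.

(** * Labelling words by positions on closed walks *)

Definition walk (V : Type) (R : V -> V -> Prop) (g : nat) (u v : V) : Prop :=
  exists W : nat -> V, [/\ W 0 = u, W g = v & forall j, j < g -> R (W j) (W j.+1)].

Lemma word_labelling (T : finType) (V : Type) (R : V -> V -> Prop) (v : V) (L : nat) :
    (forall g, L <= g -> walk V R g v v) ->
  exists (K : nat) (f : seq T -> V), forall (x : seq T) (i c : T), size x = K ->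
    R (f (i :: x)) (f (rcons x c)) \/
    f (i :: x) = f (rcons x c) /\
    forall c', c' <> c -> R (f (i :: x)) (f (rcons x c')).
Proof.
move=> walks.
have /choice[W WP] : forall g, exists W : nat -> V,
    L <= g -> [/\ W 0 = v, W g = v & forall j, j < g -> R (W j) (W j.+1)].
  move=> g; have [lt|le] := ltnP g L; first by exists (fun=> v).
  by have [W ?] := walks g le; exists W.
(* The successor makes [N] positive, as [gaps_stay] requires, and gaps other than 1 exceed [L]. *)
pose N := L.+1; pose r := radius T N; pose l := delay T N; pose D := lookahead T N.
pose y (st : nat * nat) := if st.2 == 0 then v else W st.1 st.2.
pose f (w : seq T) := if w is i :: _ then y (run (gaps T N (nth i w)) r l) else v.
(* Left context for the markers takes [r] letters, the run [l], the lookahead [D]; the head [i] is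
   one of them. *)
exists (r + l + D).-1, f => x i c sz.
have D_gt0 : 0 < D by rewrite /D /lookahead; lia.
pose z c := nth i (i :: rcons x c).
have zE c1 s : s < r + l + D -> z c1 s = nth i (i :: x) s.
  rewrite /z; case: s => //= s hs; rewrite nth_rcons; case: ltnP => //; lia.
have z_last c1 : z c1 (r + l + D) = c1.
  rewrite /z -[r + l + D]prednK ?addn_gt0 ?D_gt0 ?orbT //=.
  by rewrite nth_rcons sz ltnn eqxx.
pose st := run (gaps T N (nth i (i :: x))) r l.
have stE c1 : run (gaps T N (z c1)) r l = st.
  apply: run_ext => j hj.
  rewrite -[r + j]add0n.
  by apply: (gaps_local _ _ _ _ _ _ (r + l + D)); [exact: zE| |]; lia.
(* [rcons x c1] is the window of [z c1] shifted by one; by [run_sync] its run ends where the old run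
   is after one more step. *)
have f_next c1 : f (rcons x c1) = y (step (gaps T N (z c1)) (r + l) st).
  have -> : f (rcons x c1) = y (run (gaps T N (z c1)) r.+1 l).
    rewrite /f; case e: (rcons x c1) => [|i' w]; first by case: (x) e.
    congr y; apply: run_ext => j hj; rewrite -e addSn -add1n -[r + j]add0n.
    apply: (gaps_local _ _ _ _ _ _ (r + l + D)); [|lia|lia].
    move=> h hh; rewrite add0n add1n /z /=; apply: set_nth_default.
    by rewrite size_rcons sz; lia.
  by rewrite -run_sync -(stE c1).
have f_here : f (i :: x) = y st by [].
have st_ok : let: (g, j) := st in j = 0 /\ g = 1 \/ 0 < j < g /\ L <= g.
  have gt0 q : 0 < gaps T N (nth i (i :: x)) q by exact: gap_gt0.
  have := run_state _ gt0 r l; rewrite -/st; case: (st) => g j.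
  case=> [|[hj [q eg]]]; [by left|right; split=> //].
  have := gap_range N (marker T N (nth i (i :: x))) (fun q => periodic T N (nth i (i :: x)) q D.+1) q.
  by rewrite -[gap _ _ _ _]eg; lia.
rewrite f_here !f_next.
have moves (c1 : T) : gaps T N (z c1) (r + l) = 1 /\ st.2 = 0 \/
    R (y st) (y (step (gaps T N (z c1)) (r + l) st)).
  rewrite /step; case: (st) st_ok => g j /=.
  case=> [[-> _]|[hj leg]] /=.
    have [?|lt] := gap_range N (marker T N (z c1)) (fun q => periodic T N (z c1) q D.+1) (r + l).
      by left.
    right; rewrite -/(gaps T N (z c1) _) in lt; case: eqP => [|_]; first lia.
    have [|W0 _ Ws] := WP (gaps T N (z c1) (r + l)); first lia.
    by rewrite /y /= -W0; apply: Ws; lia.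
  right; have [W0 Wg Ws] := WP _ leg.
  have -> : (j == 0) = false by lia.
  have := Ws j ltac:(lia); rewrite /y /= (_ : (j == 0) = false); last lia.
  by case: (j.+1 =P g) => [->|_] /=; rewrite ?Wg.
case: (moves c) => [[stay st0]|]; last by left.
right; split.
  by rewrite /step st0 stay /= /y st0.
move=> c' ne; rewrite f_next; case: (moves c') => [[stay' _]|//].
case: ne; have := gaps_stay T N (z c') (z c) (r + l).
rewrite !z_last; apply=> // s hs.
by rewrite !zE.
Qed.

(** * Absorbing terms, closed walks and term trees *)

Section Absorption.
Variables (Sg : signature) (A : algebra Sg) (R : set (A * A)).
Hypotheses (A_idem : idempotent_algebra A) (R_sub : subalgebra_sq R).

Lemma eval_idempotent n (e : term Sg n) (a : A) : eval e (fun=> a) = a.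
Proof.
elim: e => [//|f es IH] /=; rewrite -[RHS](A_idem f a); congr basic_op.
by apply: funext => i; exact: IH.
Qed.

Lemma eval_compat n (e : term Sg n) (u v : 'I_n -> A) :
  (forall i, R (u i, v i)) -> R (eval e u, eval e v).
Proof.
move=> Ruv; elim: e => [//|f es IH] /=.
exact: (R_sub f (fun i => (eval (es i) u, eval (es i) v))).
Qed.

Section Tree.
Variables (n : nat) (e : term Sg n).

Fixpoint tree (K : nat) (f : seq 'I_n -> A) : A :=
  if K is K'.+1 then eval e (fun i => tree K' (fun x => f (i :: x))) else f [::].

(** Splits off the level at the leaves, the only one where absorption is applied. *)
Lemma tree_rcons K f :
  tree K.+1 f = tree K (fun x => eval e (fun c => f (rcons x c))).
Proof.
elim: K f => [//|K IH] f.
by rewrite [LHS]/=; congr eval; apply: funext => i; exact: (IH (fun x => f (i :: x))).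
Qed.

Lemma tree_compat K f g : (forall x, size x = K -> R (f x, g x)) ->
  R (tree K f, tree K g).
Proof.
elim: K f g => [|K IH] f g Rfg /=; first exact: Rfg.
by apply: eval_compat => i; apply: IH => x sz; apply: Rfg; rewrite /= sz.
Qed.

End Tree.

Hypothesis loopless : forall a : A, ~ R (a, a).
Variable n : nat.
Hypothesis R_abs : locally_n_absorbs n R diagonal.

(** Without loops, one equality and edges elsewhere give a one-in tuple in the literal sense; tuples
    of edges only need compatibility. *)
Lemma absorbing_term (I : finType) (u v : I -> 'I_n -> A) :
  exists e : term Sg n, forall k,
    (forall i, R (u k i, v k i)) \/
    (exists2 i, u k i = v k i & forall j, j <> i -> R (u k j, v k j)) ->
  R (eval e (u k), eval e (v k)).
Proof.
pose C := ([set w | @one_in (A * A) diagonal R n w] `&`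
  range (fun k i => (u k i, v k i)))%classic.
have finC : finite_set C.
  by apply: finite_setIr; apply: finite_image; exact: finite_finset.
have [|_ [e ->] eP] := R_abs C finC; first by move=> w [].
exists e => k [Ruv|[i eq_i Ruv]]; first exact: eval_compat.
apply: (eP (fun i => (u k i, v k i))); split; last by exists k.
exists i; split=> // j eq_j; apply: contrapT => /Ruv.
by rewrite [u k j]eq_j; exact: loopless.
Qed.

(* Coordinate [i] idles during the steps [i * r, ..., i * r + r - 1], where
   [r] is the remainder of the length modulo the length of the given walk; each
   coordinate then returns to its starting point, and at every step at most one
   coordinate idles. *)
Lemma closed_walks m (a : nat -> A) g :
    0 < m -> (forall i, 0 < i <= m -> R (a i.-1, a i)) -> a m = a 0 ->
  m * n <= g -> walk A (fun x y => R (x, y)) g (a 0) (a 0).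
Proof.
move=> m_gt0 Ra am g_ge; pose r := g %% m.
have lt_rm : r < m by rewrite ltn_mod.
pose b q := a (q %% m).
have Rb q : R (b q, b q.+1).
  rewrite /b -addn1 -modnDml addn1.
  have lt : q %% m < m by rewrite ltn_mod.
  have [lt'|ge] := ltnP (q %% m).+1 m; first by rewrite (modn_small lt'); apply: (Ra (q %% m).+1).
  have -> : (q %% m).+1 = m by lia.
  by rewrite modnn -am -{2}(_ : (q %% m).+1 = m); [apply: (Ra (q %% m).+1)|]; lia.
pose pos (i s : nat) := s - minn r (s - i * r).
have [e eP] := absorbing_term 'I_g (fun s i => b (pos i s)) (fun s i => b (pos i s.+1)).
exists (fun s => eval e (fun i => b (pos i s))); split.
- rewrite -[RHS](eval_idempotent n e); congr eval; apply: funext => i.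
  by rewrite /pos /b sub0n mod0n.
- rewrite -[RHS](eval_idempotent n e); congr eval; apply: funext => i.
  have le : i.+1 * r <= g.
    by apply: leq_trans g_ge; rewrite mulnC leq_mul // ltnW.
  rewrite mulSn in le.
  rewrite /b /pos (minn_idPl _); last lia.
  by rewrite /r {1}(divn_eq g m) addnK modnMl.
move=> s lt_sg; apply: (eP (Ordinal lt_sg)) => /=.
have moves (i : 'I_n) : ~ (i * r <= s < i * r + r) -> R (b (pos i s), b (pos i s.+1)).
  move=> idle; have -> : pos i s.+1 = (pos i s).+1; last exact: Rb.
  by rewrite /pos; move: idle; move: (i * r) => ir; lia.
have [[i idle]|none] := pselect (exists i : 'I_n, i * r <= s < i * r + r); last first.
  by left=> i; apply: moves => idle; apply: none; exists i.
right; exists i.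
  by congr b; rewrite /pos; move: idle; move: (i * r) => ir; lia.
move=> j ne; apply: moves => idle'; apply: ne; apply: val_inj => /=.
have sep (i1 i2 : nat) : i1 < i2 -> i1 * r + r <= i2 * r.
  by move=> lt; rewrite -mulSnr leq_mul.
by case: (ltngtP j i) => // /sep; lia.
Qed.

Lemma no_closed_walk : ~ has_closed_walk R.
Proof.
move=> [m [a [m_gt0 Ra am]]].
have [|K [f fP]] := word_labelling 'I_n A (fun x y => R (y, x)) (a 0) (m * n).
  move=> g /(closed_walks _ _ _ m_gt0 Ra am)[W [W0 Wg Ws]].
  (* The labelling uses the opposite relation, so the walk is reversed. *)
  exists (fun j => W (g - j)); split; rewrite ?subn0 ?subnn // => j lt_jg.
  have := Ws (g - j.+1); rewrite (_ : (g - j.+1).+1 = g - j); last lia.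
  by apply; lia.
have [e eP] := absorbing_term (K.-tuple 'I_n * 'I_n)%type
  (fun k c => f (rcons k.1 c)) (fun k _ => f (k.2 :: k.1)).
pose p := tree n e K.+1 f.
have Rp i : R (p, tree n e K (fun x => f (i :: x))).
  rewrite /p tree_rcons; apply: tree_compat => x sz.
  (* Idempotence adds a constant last level to the subtree, matching the last level split off from
     [p]. *)
  rewrite -[X in R (_, X)](eval_idempotent n e).
  apply: (eP (Tuple (introT eqP sz), i)) => /=.
  have [?|] := pselect (forall c, R (f (rcons x c), f (i :: x))); first by left.
  move=> /existsNP[c nR]; right; exists c.
    by case: (fP x i c sz) => // -[].
  by case: (fP x i c sz) => // -[].
apply: (loopless p); rewrite -[X in R (X, _)](eval_idempotent n e).
exact: eval_compat.
Qed.

End Absorption.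

Theorem theorem30 (Sg : signature) (A : algebra Sg) (R : set (A * A)) :
  idempotent_algebra A ->
  subalgebra_sq R ->
  has_closed_walk R ->
  locally_absorbs R diagonal ->
  exists a : A, R (a, a).
Proof.
move=> A_idem R_sub cw [n R_abs]; apply: contrapT => noloop.
apply: (no_closed_walk _ _ _ A_idem R_sub _ n R_abs cw) => a Raa.
by apply: noloop; exists a.
Qed.
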